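(* Let $r,n$ be integers with $0\le r<n$, let $X=\mathcal{P}_n$, and let $$C=C_{n,r}:=\{p\in\mathcal{P}_n\mid p^{(r)}(t)\ge 0\text{ for all }t\in[-1,1]\}.$$ Let $x\in X\setminus C$ and $x_0\in C$, and for $\alpha\in[-1,1]$ let $k_\alpha:=\sum_{i=0}^n p_i^{(r)}(\alpha)\,p_i$. Then the following statements are equivalent: (1) $x_0=P_C(x)$; (2) $x_0=x+\sum_{i=1}^m\rho_i k_{\alpha_i}$, where $m\le n+1$, $\rho_i>0$, $\alpha_i\in[-1,1]$ and $x_0^{(r)}(\alpha_i)=0$ for all $i$, and $\{k_{\alpha_1},k_{\alpha_2},\dots,k_{\alpha_m}\}$ is linearly independent. Moreover, if $x_0^{(r)}\not\equiv 0$ in any of the statements above, then $$m\le\tfrac12(n-r+2).$$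
   Context: $\mathcal{P}_n$ is the space of real polynomials of degree at most $n$, regarded as a subspace of $L_2[-1,1]$ with inner product $\langle f,g\rangle=\int_{-1}^1 f(t)g(t)\,dt$. $\{p_0,p_1,\dots,p_n\}$ is an orthonormal basis of $\mathcal{P}_n$; for definiteness, the normalized Legendre polynomials. $p^{(r)}$ denotes the $r$th derivative (with $p^{(0)}=p$). $C$ is a closed convex cone, and $P_C(x)$ is the unique best approximation (nearest point in the $L_2[-1,1]$ norm) to $x$ in $C$. *)

(* Defs.v *)
From HB Require Import structures.
From mathcomp Require Import all_boot all_order all_algebra.
From mathcomp Require Import all_classical all_reals all_analysis.
From mathcomp Require Import zify ring lra.
Import Order.TTheory GRing.Theory Num.Theory.
Import numFieldNormedType.Exports.

Set Implicit Arguments.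
Unset Strict Implicit.
Unset Printing Implicit Defensive.

Local Open Scope classical_set_scope.
Local Open Scope ring_scope.

Definition dotL2 (R : realType) (f g : {poly R}) : R :=
  (\int[lebesgue_measure]_(t in `[-1, 1]) (f.[t] * g.[t])).

Definition normL2 (R : realType) (f : {poly R}) : R := Num.sqrt (dotL2 f f).

Definition orthonormal_basis (R : realType) (n : nat)
    (p : n.+1.-tuple {poly_n.+1 R}) : Prop :=
  basis_of fullv p /\
  forall i j : 'I_n.+1, dotL2 (tnth p i) (tnth p j) = (i == j)%:R.

(* Rodrigues' formula; the factor sqrt((2k+1)/2) makes the L2-norm equal to 1. *)
Definition legendre (R : realType) (k : nat) : {poly R} :=
  (Num.sqrt ((2 * k + 1)%:R / 2) / (2 ^+ k * k`!%:R)) *: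
  ((('X^2 - 1) ^+ k)^`(k)).

Definition legendre_tuple (R : realType) (n : nat) :
    n.+1.-tuple {poly_n.+1 R} :=
  [tuple npolyp n.+1 (legendre R i) | i < n.+1].

Section Legendre.
Variable R : realType.
Implicit Types (f g h : {poly R}) (c : R).

Let integrable_horner f :
  lebesgue_measure.-integrable `[(-1 : R), 1] (EFin \o horner f).
Proof.
apply: continuous_compact_integrable; first exact: segment_compact.
by apply: continuous_subspaceT => x; exact: continuous_horner.
Qed.

Lemma dotL2E f g :
  dotL2 f g = \int[lebesgue_measure]_(t in `[-1, 1]) (f * g).[t].
Proof. by apply: eq_Rintegral => t _; rewrite hornerM. Qed.

Lemma dotL2C f g : dotL2 f g = dotL2 g f.
Proof. by rewrite !dotL2E mulrC. Qed.

Lemma dotL2Dl f g h : dotL2 (f + g) h = dotL2 f h + dotL2 g h.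
Proof.
rewrite !dotL2E -RintegralD //; try exact: integrable_horner.
by apply: eq_Rintegral => t _; rewrite mulrDl hornerD.
Qed.

Lemma dotL2Zl c f h : dotL2 (c *: f) h = c * dotL2 f h.
Proof.
rewrite !dotL2E -RintegralZl //; try exact: integrable_horner.
by apply: eq_Rintegral => t _; rewrite -scalerAl hornerZ.
Qed.

Lemma dotL20l h : dotL2 0 h = 0.
Proof. by have := dotL2Zl 0 0 h; rewrite scaler0 mul0r. Qed.

Lemma dotL2Zr c f h : dotL2 f (c *: h) = c * dotL2 f h.
Proof. by rewrite dotL2C dotL2Zl dotL2C. Qed.

Lemma dotL20r h : dotL2 h 0 = 0.
Proof. by rewrite dotL2C dotL20l. Qed.

Lemma dotL2_suml I (s : seq I) (F : I -> {poly R}) h :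
  dotL2 (\sum_(i <- s) F i) h = \sum_(i <- s) dotL2 (F i) h.
Proof.
elim: s => [|i s IH]; first by rewrite !big_nil dotL20l.
by rewrite !big_cons dotL2Dl IH.
Qed.

Lemma dotL2_parts f g :
  dotL2 f^`() g = ((f * g).[1] - (f * g).[-1]) - dotL2 f g^`().
Proof.
have LR h : derivable_oo_LRcontinuous (horner h) (-1 : R) 1.
  split; first by move=> x _; exact: derivable_horner.
    by apply: cvg_at_right_filter; exact: continuous_horner.
  by apply: cvg_at_left_filter; exact: continuous_horner.
have C h : {within `[(-1 : R), 1], continuous (horner h)}.
  by apply: continuous_subspaceT => x; exact: continuous_horner.
rewrite dotL2C /dotL2.
rewrite (@Rintegration_by_parts R (horner g) (horner f) (horner g^`()) (horner f^`()))//.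
- rewrite !hornerM ![g.[_] * _]mulrC; congr (_ - _).
  by apply: eq_Rintegral => t _; rewrite mulrC.
- by move=> x _; rewrite -derivE.
- by move=> x _; rewrite -derivE.
Qed.

Lemma derivn_root_exp (a : R) k j q : (j < k)%N ->
  ((('X - a%:P) ^+ k * q)^`(j)).[a] = 0.
Proof.
elim: j k q => [|j IH] [|k] q // jk.
  by rewrite derivn0 hornerM horner_exp hornerXsubC subrr expr0n mul0r.
rewrite derivSn derivM deriv_exp derivXsubC mul1r /=.
rewrite [X in X^`(j)](_ : _ =
    ('X - a%:P) ^+ k * (q *+ k.+1 + ('X - a%:P) * q^`())) ?IH//.
by rewrite mulrDr mulrnAl mulrnAr mulrA exprSr.
Qed.

Notation w k := (('X^2 - 1 : {poly R}) ^+ k).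

Let w1 k j : (j < k)%N -> ((w k)^`(j)).[1] = 0.
Proof.
move=> jk; rewrite (_ : 'X^2 - 1 = ('X - 1%:P) * ('X + 1%:P)); last by rewrite polyC1 -subr_sqr_1.
by rewrite exprMn derivn_root_exp.
Qed.

Let wN1 k j : (j < k)%N -> ((w k)^`(j)).[-1] = 0.
Proof.
move=> jk; rewrite (_ : 'X^2 - 1 = ('X - (-1)%:P) * ('X - 1%:P)); last first.
  by rewrite polyCN opprK polyC1 mulrC -subr_sqr_1.
by rewrite exprMn derivn_root_exp.
Qed.

Let dot_w k g : dotL2 (w k)^`(k) g = (-1) ^+ k * dotL2 (w k) g^`(k).
Proof.
suff H j : (j <= k)%N ->
    dotL2 (w k)^`(k) g = (-1) ^+ j * dotL2 (w k)^`(k - j) g^`(j).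
  by rewrite (H k)// subnn derivn0.
elim: j => [|j IH] jk; first by rewrite expr0 mul1r subn0.
rewrite (IH (ltnW jk)) (_ : k - j = (k - j.+1).+1)%N; last by lia.
have kj : (k - j.+1 < k)%N by lia.
rewrite !derivnS dotL2_parts !hornerM (w1 kj) (wN1 kj).
by rewrite [(-1) ^+ j.+1]exprS !mul0r; ring.
Qed.

Let monic_w k : w k \is monic.
Proof. by rewrite monic_exp// -polyC1 monicXnsubC. Qed.

Let size_w k : size (w k) = (2 * k).+1.
Proof.
rewrite polySpred ?monic_neq0 ?monic_w// size_exp -polyC1 size_XnsubC//.
Qed.

Let w_ortho j k : (j < k)%N -> dotL2 (w k)^`(k) (w j)^`(j) = 0.
Proof.
move=> jk; rewrite dot_w (_ : (w j)^`(j)^`(k) = 0) ?dotL20r ?mulr0//.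
by rewrite /derivn -iterD; apply: derivn_poly0; rewrite size_w; lia.
Qed.

Let dot_w1S k :
  (2 * k + 3)%:R * dotL2 (w k.+1) 1 = - ((2 * k + 2)%:R * dotL2 (w k) 1).
Proof.
have E : dotL2 (w k.+1) 1 =
    - ((2 * k + 2)%:R * (dotL2 (w k.+1) 1 + dotL2 (w k) 1)).
  rewrite {1}dotL2C -{1}(derivX R) dotL2_parts !hornerM.
  rewrite (w1 (ltn0Sn k)) (wN1 (ltn0Sn k)) !mulr0 subr0 sub0r -dotL2Dl -dotL2Zl.
  congr (- _); rewrite !dotL2E; congr (\int[_]_(_ in _) horner _ _).
  have -> : (w k.+1)^`() = ('X *+ 2) * w k *+ k.+1.
    by rewrite deriv_exp derivB derivXn -polyC1 derivC subr0.
  have -> : w k.+1 + w k = 'X^2 * w k.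
    by rewrite exprS -[X in _ + X]mul1r -mulrDl subrK.
  rewrite mulr1.
  rewrite (_ : 2 * k + 2 = k.+1 * 2)%N; last by lia.
  rewrite scaler_nat mulrnA !(mulrnAl, mulrnAr) -!mulrnA mulrA.
  by rewrite -expr2 mulnC.
have -> : (2 * k + 3)%:R = (2 * k + 2)%:R + 1 :> R by rewrite natr1; congr _%:R; lia.
by rewrite mulrDl mul1r {2}E mulrDr opprD addrA subrr add0r.
Qed.

Let dot_w1 k : (2 * k + 1)`!%:R * ((-1) ^+ k * dotL2 (w k) 1) =
  2 * (2 ^+ k * k`!%:R) ^+ 2 :> R.
Proof.
elim: k => [|k IH].
  rewrite !expr0 muln0 add0n !mul1r expr1n mulr1 -{1}(derivX R) dotL2_parts.
  by rewrite mulr1 !hornerX -polyC1 derivC dotL20r; ring.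
have -> : (2 * k.+1 + 1 = (2 * k + 1).+2)%N by lia.
rewrite !factS !natrM.
have -> : (2 * k + 1).+2%:R = (2 * k + 3)%:R :> R by congr _%:R; lia.
have -> : (2 * k + 1).+1%:R = (2 * k + 2)%:R :> R by congr _%:R; lia.
transitivity ((2 * k + 2)%:R * (2 * k + 1)`!%:R * (-1) ^+ k.+1 *
    ((2 * k + 3)%:R * dotL2 (w k.+1) 1) : R); first by ring.
rewrite dot_w1S.
transitivity ((2 * k + 2)%:R ^+ 2 *
    ((2 * k + 1)`!%:R * ((-1) ^+ k * dotL2 (w k) 1)) : R).
  by rewrite [(-1) ^+ k.+1]exprS; ring.
have -> : (2 * k + 2)%:R = 2 * k.+1%:R :> R by rewrite -natrM; congr _%:R; lia.
by rewrite IH [2 ^+ k.+1]exprS; ring.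
Qed.

Let w_norm k : dotL2 (w k)^`(k) (w k)^`(k) =
  (2 ^+ k * k`!%:R) ^+ 2 / ((2 * k + 1)%:R / 2) :> R.
Proof.
rewrite dot_w (_ : (w k)^`(k)^`(k) = (2 * k)`!%:R *: 1); last first.
  rewrite /derivn -iterD -/(derivn _ _) addnn -mul2n.
  apply/polyP => i; rewrite coef_derivn coefZ coef1.
  case: i => [|i].
    rewrite addn0 ffactnn mulr1.
    have /monicP := monic_w k; rewrite lead_coefE size_w /= => ->.
    by [].
  by rewrite nth_default ?mul0rn ?mulr0// size_w; lia.
rewrite dotL2Zr.
apply: (@mulfI _ (2 * k + 1)%:R); first by rewrite pnatr_eq0 addn1.
have := dot_w1 k; rewrite addn1 factS natrM => E.
rewrite [LHS](_ : _ = 2 * (2 ^+ k * k`!%:R) ^+ 2); last by rewrite -E; ring.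
field.
by rewrite -natrM nat1r pnatr_eq0.
Qed.

Let legendre_size k : (size (legendre R k) <= k.+1)%N.
Proof.
apply: (leq_trans (size_scale_leq _ _)); apply/leq_sizeP => j kj.
by rewrite coef_derivn nth_default ?mul0rn// size_w; lia.
Qed.

Lemma legendre_orthonormal j k :
  dotL2 (legendre R j) (legendre R k) = (j == k)%:R.
Proof.
wlog jk : j k / (j <= k)%N.
  move=> H; case: (leqP j k) => [|/ltnW] /H // {}H.
  by rewrite dotL2C H eq_sym.
rewrite /legendre dotL2Zl dotL2Zr.
move: jk; rewrite leq_eqVlt => /orP[/eqP ->|jk]; last first.
  by rewrite dotL2C w_ortho// !mulr0 ltn_eqF.
have A0 : 2 ^+ k * k`!%:R != 0 :> R.
  by rewrite mulf_neq0 ?expf_neq0 ?pnatr_eq0// -lt0n fact_gt0.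
have B0 : 0 < (2 * k + 1)%:R / 2 :> R by rewrite divr_gt0// ltr0n addn1.
rewrite eqxx w_norm; move: A0 B0.
move: (2 ^+ k * k`!%:R) ((2 * k + 1)%:R / 2) => A B A0 B0.
have := lt0r_neq0 B0; rewrite mulrA -expr2 exprMn sqr_sqrtr ?ltW// => {}B0.
rewrite mulr1n; field.
by rewrite A0 B0.
Qed.

Lemma orthonormal_basisP n (p : n.+1.-tuple {poly_n.+1 R}) :
  (forall i j, dotL2 (tnth p i) (tnth p j) = (i == j)%:R) ->
  orthonormal_basis p.
Proof.
move=> pp; split=> //.
rewrite basisEfree subvf size_tuple dim_polyn leqnn !andbT.
apply/freeP => u u0 i.
have : dotL2 (\sum_(j < n.+1) u j *: p`_j : {poly_n.+1 R}) (tnth p i) = 0.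
  by rewrite u0 dotL20l.
rewrite raddf_sum /= dotL2_suml (bigD1 i)//= big1 => [|j ji].
  by rewrite addr0 dotL2Zl -tnth_nth pp eqxx mulr1.
by rewrite dotL2Zl -tnth_nth pp (negbTE ji) mulr0.
Qed.

Lemma legendre_orthonormal_basis n : orthonormal_basis (legendre_tuple R n).
Proof.
apply: orthonormal_basisP => i j; rewrite !tnth_mktuple !npolypK.
- exact: legendre_orthonormal.
- exact: leq_trans (legendre_size _) _.
- exact: leq_trans (legendre_size _) _.
Qed.

End Legendre.

(* The metric projection P_C, as the set of nearest points of C: "y is the
   unique best approximation to x in C" reads [best_approx C x = [set y]]. *)
Definition best_approx (R : realType) (n : nat) (C : set {poly_n.+1 R})
    (x : {poly_n.+1 R}) : set {poly_n.+1 R} :=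
  [set y | C y /\ forall z, C z -> normL2 (x - y) <= normL2 (x - z)].

Definition nnderiv_cone (R : realType) (n r : nat) : set {poly_n.+1 R} :=
  [set p | forall t : R, t \in `[-1, 1] -> 0 <= p^`(r).[t]].

Arguments nnderiv_cone R n r : clear implicits.

Definition kernel_poly (R : realType) (n r : nat)
    (p : n.+1.-tuple {poly_n.+1 R}) (a : R) : {poly_n.+1 R} :=
  \sum_(i < n.+1) ((tnth p i)^`(r)).[a] *: tnth p i.

(* [free] is linear independence of the indexed family, so it forces the
   k_(alpha i), hence the alpha i, to be pairwise distinct. *)
Definition kernel_representation (R : realType) (n r : nat)
    (p : n.+1.-tuple {poly_n.+1 R}) (x x0 : {poly_n.+1 R})
    (m : nat) (rho alpha : 'I_m -> R) : Prop :=
  [/\ (m <= n.+1)%N,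
      x0 = x + \sum_(i < m) rho i *: kernel_poly r p (alpha i),
      forall i, 0 < rho i,
      forall i, alpha i \in `[-1, 1] /\ x0^`(r).[alpha i] = 0 &
      free [tuple kernel_poly r p (alpha i) | i < m]].

(* Main.v *)
Require Import Defs.
From mathcomp Require Import all_boot all_order all_algebra.
From mathcomp Require Import all_classical all_reals all_analysis.
From mathcomp Require Import zify ring lra.
Import Order.TTheory GRing.Theory Num.Theory.
Import numFieldNormedType.Exports.
Set Implicit Arguments.
Unset Strict Implicit.
Unset Printing Implicit Defensive.
Local Open Scope classical_set_scope.
Local Open Scope ring_scope.

(** The functional h |-> h^(r)(t) on the polynomials of degree at most n is the
inner product with k_t ([kernel_polyE]), so that C is exactly the dual cone of
the family k_t, t in [-1, 1].  A nearest point x0 of a convex cone is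
characterised by <x - x0, z> <= 0 on the cone and <x - x0, x0> = 0
([nearest_polar], [polar_nearest]).

If x0 - x is a positive combination of kernels k_t at zeros t of x0^(r), this
characterisation holds for C by a direct computation.  Conversely it says that
v = x0 - x is in the dual of C, i.e. in the bidual of the cone K spanned by the
k_t.  The point is that K is its own bidual ([kernel_cone_dual]): if w is a
point of K nearest to v, then w - v lies in C, hence <v, w - v> >= 0, while
<w, w - v> = 0, and so w = v.  A nearest point exists ([kernel_cone_nearest])
because, by Caratheodory's theorem for cones, n + 1 kernels suffice to write
any element of K, the nodes lie in [-1, 1], and the total weight of an element
close to v is bounded: it is the inner product with a polynomial whose r-th
derivative is 1.  The distance to v is thus minimised over a compact box.
Caratheodory's theorem also makes the kernels in the representation of x0 - x
linearly independent, and <x0 - x, x0> = 0 is a vanishing sum of nonnegative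
terms rho_i x0^(r)(alpha_i), so that every alpha_i is a zero of x0^(r).

For the bound on m, x0^(r) is nonnegative on [-1, 1], so its zeros in the open
interval are at least double.  Multiplying by 1 - t^2 makes possible zeros at
the endpoints double as well, so 2m is at most the degree of the product,
which is at most n - r + 2. *)

(** * The inner product and expansions in an orthonormal basis *)

Section Dot.
Variable R : realType.
Implicit Types f g h : {poly R}.

Lemma dotL2Dr f g h : dotL2 f (g + h) = dotL2 f g + dotL2 f h.
Proof. by rewrite dotL2C dotL2Dl !(dotL2C f). Qed.

Lemma dotL2_sumr I (s : seq I) (F : I -> {poly R}) h :
  dotL2 h (\sum_(i <- s) F i) = \sum_(i <- s) dotL2 h (F i).
Proof.
by rewrite dotL2C dotL2_suml; apply: eq_bigr => i _; exact: dotL2C.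
Qed.

Lemma dotL2Bl f g h : dotL2 (f - g) h = dotL2 f h - dotL2 g h.
Proof. by rewrite dotL2Dl -scaleN1r dotL2Zl mulN1r. Qed.

Lemma dotL2Br f g h : dotL2 f (g - h) = dotL2 f g - dotL2 f h.
Proof. by rewrite dotL2C dotL2Bl !(dotL2C f). Qed.

Lemma dotL2_sqrB f g :
  dotL2 (f - g) (f - g) = dotL2 f f - 2 * dotL2 f g + dotL2 g g.
Proof. by rewrite dotL2Bl !dotL2Br (dotL2C g f); ring. Qed.

Lemma dotL2_ge0 f : 0 <= dotL2 f f.
Proof. by apply: Rintegral_ge0 => t _; rewrite -expr2 sqr_ge0. Qed.

Lemma le_normL2 f g :
  (normL2 f <= normL2 g) = (dotL2 f f <= dotL2 g g).
Proof. by rewrite /normL2 ler_sqrt ?dotL2_ge0. Qed.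

End Dot.

Section Basis.
Variables (R : realType) (n : nat) (p : n.+1.-tuple {poly_n.+1 R}).
Hypothesis hp : orthonormal_basis p.
Implicit Types h : {poly_n.+1 R}.

Lemma orthonormal_expansion h :
  h = \sum_(i < n.+1) dotL2 h (tnth p i) *: (tnth p i : {poly R}) :> {poly R}.
Proof.
have [pb pp] := hp.
have := congr1 (@polyn R n.+1) (coord_basis pb (memvf h)).
rewrite raddf_sum /= => hE; rewrite [LHS]hE; apply: eq_bigr => i _.
rewrite -tnth_nth; congr (_ *: _).
rewrite hE dotL2_suml (bigD1 i)//= big1 => [|j ji].
  by rewrite addr0 dotL2Zl -tnth_nth pp eqxx mulr1.
by rewrite dotL2Zl -tnth_nth pp (negbTE ji) mulr0.
Qed.

Lemma parseval h : dotL2 h h = \sum_(i < n.+1) dotL2 h (tnth p i) ^+ 2.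
Proof.
rewrite {2}(orthonormal_expansion h) dotL2_sumr.
by apply: eq_bigr => i _; rewrite dotL2Zr.
Qed.

(** The reproducing property; it turns the sign condition defining the cone C
into inequalities between inner products. *)
Lemma kernel_polyE r h a : dotL2 h (kernel_poly r p a) = h^`(r).[a].
Proof.
rewrite [in RHS](orthonormal_expansion h) /kernel_poly raddf_sum /=.
rewrite dotL2_sumr linear_sum /= horner_sum.
by apply: eq_bigr => i _; rewrite dotL2Zr derivnZ hornerZ mulrC.
Qed.

End Basis.

Lemma dotL2_eq0 (R : realType) n (h : {poly_n.+1 R}) : dotL2 h h = 0 -> h = 0.
Proof.
have ob := legendre_orthonormal_basis R n.
rewrite (parseval ob) => /eqP; rewrite psumr_eq0; last by move=> i _; exact: sqr_ge0.
move=> /allP h0; apply: val_inj; rewrite /= (orthonormal_expansion ob h).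
rewrite big1 // => i _.
have /h0 := mem_index_enum i; rewrite /= sqrf_eq0 => /eqP ->.
exact: scale0r.
Qed.

(** * Nearest points of convex cones *)

Section Projection.
Variables (R : realType) (n : nat) (C : set {poly_n.+1 R}).
Hypothesis CD : forall y z, C y -> C z -> C (y + z).
Hypothesis CZ : forall (e : R) y, 0 <= e -> C y -> C (e *: y).

(** First-order optimality at e = 0; for a > 0 the parabola is negative at
e = a / (a + b), which lies in [0, 1] whatever b >= 0 is. *)
Let quad_le0 (a b : R) : 0 <= b ->
  (forall e, 0 <= e <= 1 -> 0 <= - (2 * e * a) + e ^+ 2 * b) -> a <= 0.
Proof.
move=> b0 H; rewrite leNgt; apply/negP => a0.
have ab : 0 < a + b by lra.
have /H : 0 <= a / (a + b) <= 1.
  by rewrite ler_pdivrMr// mul1r lerDl b0 divr_ge0// ltW.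
rewrite leNgt => /negP; apply.
rewrite (_ : _ + _ = - (a ^+ 2 * (2 * a + b) / (a + b) ^+ 2)); last first.
  by field; rewrite gt_eqF.
by rewrite oppr_lt0 divr_gt0 ?mulr_gt0 ?exprn_gt0//; lra.
Qed.

Let nearest_along (x y z : {poly_n.+1 R}) : best_approx C x y ->
  (forall e : R, 0 <= e <= 1 -> C (y + e *: z)) -> dotL2 (x - y) z <= 0.
Proof.
move=> [_ ymin] yz; apply: (@quad_le0 _ (dotL2 z z)); first exact: dotL2_ge0.
move=> e e01; have := ymin _ (yz e e01); rewrite le_normL2.
have -> : polyn (x - (y + e *: z)) = polyn x - polyn y - e *: polyn z.
  by rewrite opprD addrA !raddfB.
have -> : polyn (x - y) = polyn x - polyn y by rewrite raddfB.
rewrite (dotL2_sqrB (_ - _)) !dotL2Zr dotL2Zl => H.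
by move: (dotL2 (_ - _) z) H => a; lra.
Qed.

(** From a nearest point y of the cone one can move along y + e z for z in the
cone, and also towards the origin along y - e y, without leaving it; optimality
in these directions gives the inequality and the equality. *)
Lemma nearest_polar (x y : {poly_n.+1 R}) : best_approx C x y ->
  (forall z, C z -> dotL2 (x - y) z <= 0) /\ dotL2 (x - y) y = 0.
Proof.
move=> xy; have [Cy _] := xy.
have P z : C z -> dotL2 (x - y) z <= 0.
  by move=> Cz; apply: nearest_along => // e /andP[e0 _]; apply/CD/CZ.
split=> //; apply/eqP; rewrite eq_le P//= -oppr_le0.
have -> : - dotL2 (x - y) y = dotL2 (x - y) (polyn (- y)).
  have -> : polyn (- y) = -1 *: polyn y by rewrite raddfN scaleN1r.
  by rewrite dotL2Zr mulN1r.
apply: nearest_along => // e /andP[e0 e1].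
have -> : y + e *: - y = (1 - e) *: y by rewrite scalerN scalerBl scale1r.
by apply: CZ => //; rewrite subr_ge0.
Qed.

(** Since |x - z|^2 = |x - y|^2 - 2 <x - y, z> + |z - y|^2 under the
orthogonality hypothesis, the inequality <x - y, z> <= 0 makes y the only
minimiser. *)
Lemma polar_nearest (x y : {poly_n.+1 R}) : C y ->
  (forall z, C z -> dotL2 (x - y) z <= 0) -> dotL2 (x - y) y = 0 ->
  best_approx C x = [set y].
Proof.
move=> Cy P xyy.
have D (z : {poly_n.+1 R}) : dotL2 (x - z) (x - z) =
    dotL2 (x - y) (x - y) - 2 * dotL2 (x - y) z + dotL2 (z - y) (z - y).
  have -> : x - z = (x - y) - (z - y) :> {poly R} by rewrite opprB addrA subrK.
  by rewrite dotL2_sqrB (dotL2Br _ z) xyy subr0.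
have xyE z : polyn (x - z) = polyn x - polyn z by rewrite raddfB.
apply/seteqP; split=> z /=.
  move=> [Cz /(_ _ Cy)]; rewrite le_normL2 !xyE D => H.
  apply/eqP; rewrite -subr_eq0; apply/eqP/dotL2_eq0; rewrite raddfB /=.
  have := dotL2_ge0 (polyn z - polyn y); have := P z Cz; lra.
move=> ->; split=> // w Cw; rewrite le_normL2 !xyE (D w).
have := dotL2_ge0 (polyn w - polyn y); have := P w Cw; lra.
Qed.

End Projection.

(** * Caratheodory for cones *)

(** A linear relation among the vectors allows the weights to be moved without
changing the sum until one of them reaches 0; that vector is then dropped.  The
map [f] selects the vectors which are kept. *)
Lemma conic_caratheodory (F : realFieldType) (V : vectType F) m
    (k : 'I_m -> V) (rho : 'I_m -> F) : (forall i, 0 <= rho i) ->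
  exists m' (f : 'I_m' -> 'I_m) (rho' : 'I_m' -> F),
    [/\ forall i, 0 < rho' i, free [tuple k (f i) | i < m'] &
        \sum_i rho i *: k i = \sum_i rho' i *: k (f i)].
Proof.
elim: m k rho => [|m IH] k rho rho0.
  exists 0%N, id, rho; split=> //; first by case.
  by apply/freeP => u _ [].
have drop c i : (forall j, 0 <= c j) -> c i = 0 ->
    \sum_j rho j *: k j = \sum_j c j *: k j ->
  exists m' (f : 'I_m' -> 'I_m.+1) (rho' : 'I_m' -> F),
    [/\ forall i, 0 < rho' i, free [tuple k (f i) | i < m'] &
        \sum_i rho i *: k i = \sum_i rho' i *: k (f i)].
  move=> c0 ci ->; have [m' [f [rho' [rho'0 fr E]]]] :=
    IH (k \o lift i) (c \o lift i) (fun j => c0 _).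
  exists m', (lift i \o f), rho'; split=> //.
  by rewrite (bigD1_ord i)//= ci scale0r add0r.
have [fr|nfr] := boolP (free [tuple k i | i < m.+1]); last first.
  have [u [u0 [j uj]]] : exists u,
      \sum_(i < m.+1) u i *: k i = 0 /\ exists j, 0 < u j.
    have [u /not_implyP[u0 uN]] : exists u : 'I_m.+1 -> F,
        ~ (\sum_(i < m.+1) u i *: [tuple k i | i < m.+1]`_i = 0 ->
           forall i, u i = 0).
      by apply/existsNP => H; move/negP: nfr; apply; apply/freeP.
    have [j /eqP uj] := (existsNP _).2 uN.
    have {}u0 : \sum_(i < m.+1) u i *: k i = 0.
      by rewrite -[RHS]u0; apply: eq_bigr => i _; rewrite -tnth_nth tnth_mktuple.
    have [uj0|uj0|uj0] := ltgtP (u j) 0; last by rewrite uj0 eqxx in uj.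
      exists (fun i => - u i); split; last by exists j; rewrite oppr_gt0.
      by under eq_bigr do rewrite scaleNr; rewrite sumrN u0 oppr0.
    by exists u; split=> //; exists j.
  (* The largest multiple of the relation that keeps every weight nonnegative
     is the least ratio rho i / u i over the positive u i. *)
  have [i ui imin] :=
    @arg_minP _ _ _ j (fun i => 0 < u i) (fun i => rho i / u i) uj.
  pose t := rho i / u i.
  have t0 : 0 <= t by rewrite divr_ge0 // ltW.
  apply: (drop (fun l => rho l - t * u l) i) => [l||].
  - rewrite subr_ge0; have [ul|ul] := ltP 0 (u l).
      by rewrite -ler_pdivlMr//; exact: imin.
    by rewrite (le_trans _ (rho0 l))// mulr_ge0_le0.
  - by rewrite /t divfK ?subrr// gt_eqF.
  - under [RHS]eq_bigr do rewrite scalerBl -scalerA.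
    by rewrite sumrB -scaler_sumr u0 scaler0 subr0.
have [/forallP pos|/forallPn/= [i]] := boolP [forall i, 0 < rho i].
  by exists m.+1, id, rho; split.
by rewrite lt_neqAle rho0 andbT negbK => /eqP ri; apply: (drop rho i).
Qed.

(** * Zeros of polynomials that are nonnegative on [-1, 1] *)

Section DoubleZeros.
Variable R : realType.

Lemma dvdp_sqr_XsubC (F : fieldType) (q : {poly F}) a :
  root q a -> root q^`() a -> ('X - a%:P) ^+ 2 %| q.
Proof.
rewrite -!dvdp_XsubCl => /dvdpP[g ->].
rewrite derivM derivXsubC mulr1 dvdp_addr ?dvdp_mulIr// => ag.
by rewrite expr2 dvdp_mul2r ?polyXsubC_eq0.
Qed.

Lemma dvdp_prod_sqr_XsubC (F : fieldType) (q : {poly F}) (s : seq F) :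
  uniq s -> (forall a, a \in s -> ('X - a%:P) ^+ 2 %| q) ->
  (\prod_(a <- s) ('X - a%:P)) ^+ 2 %| q.
Proof.
elim: s => [|a s IH] /=; first by rewrite big_nil expr1n dvd1p.
move=> /andP[as_ us] H; rewrite big_cons exprMn Gauss_dvdp.
  rewrite H ?mem_head//= IH// => b bs.
  by apply: H; rewrite inE bs orbT.
apply/coprimep_expl/coprimep_expr; rewrite coprimep_sym coprimep_XsubC.
by rewrite root_prod_XsubC.
Qed.

(** Such a zero is an interior minimum. *)
Lemma nonneg_interior_zero (q : {poly R}) a :
  (forall t, t \in `[-1, 1] -> 0 <= q.[t]) -> a \in `]-1, 1[ ->
  root q a -> root q^`() a.
Proof.
move=> q0 a1 /rootP qa; apply/rootP; rewrite derivE derive1E.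
have D := @derive1_at_min R (horner q) (-1) 1 a.
apply: (@derive_val _ _ _ _ _ _ _ (D _ _ a1 _)).
- by lra.
- by move=> t _; exact: derivable_horner.
- by move=> t t1; rewrite qa q0// subset_itv_oo_cc.
Qed.

(** Multiplying by 1 - X^2 turns zeros at the endpoints into double zeros at the
cost of raising the degree by 2; all zeros of the product under consideration
are then double. *)
Lemma nonneg_zero_count (q : {poly R}) (s : seq R) : q != 0 ->
  (forall t, t \in `[-1, 1] -> 0 <= q.[t]) -> uniq s ->
  (forall a, a \in s -> a \in `[-1, 1] /\ q.[a] = 0) ->
  (2 * size s < size q + 2)%N.
Proof.
move=> qN0 q0 us H; pose w : {poly R} := 1 - 'X^2.
have wE : w = - (('X - 1%:P) * ('X - (-1)%:P)).
  by rewrite /w polyCN opprK polyC1 -subr_sqr_1 opprB.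
have sw : size w = 3%N by rewrite /w -opprB size_polyN -polyC1 size_XnsubC.
have w0 : w != 0 by rewrite -size_poly_gt0 sw.
have : (\prod_(a <- s) ('X - a%:P)) ^+ 2 %| w * q.
  apply: dvdp_prod_sqr_XsubC => // a /H[a1 /rootP qa].
  have aq : 'X - a%:P %| q by rewrite dvdp_XsubCl.
  have end_zero : w.[a] = 0 -> ('X - a%:P) ^+ 2 %| w * q.
    by move=> /rootP wa; rewrite expr2 dvdp_mul// dvdp_XsubCl.
  have [a1E|aN1] := eqVneq a 1.
    by apply: end_zero; rewrite wE a1E !hornerE subrr mul0r oppr0.
  have [a1E|aNN1] := eqVneq a (-1).
    by apply: end_zero; rewrite wE a1E !hornerE opprK addNr mulr0 oppr0.
  apply/dvdp_mull/dvdp_sqr_XsubC => //; apply: nonneg_interior_zero => //.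
  move: a1; rewrite !in_itv /= => /andP[a1 a2].
  by rewrite !lt_neqAle a1 a2 aN1 eq_sym aNN1.
move=> /dvdp_leq; rewrite mulf_eq0 negb_or w0 qN0 => /(_ isT).
have P0 : \prod_(a <- s) ('X - a%:P) != 0 by rewrite monic_neq0 ?monic_prod_XsubC.
rewrite expr2 !size_mul// (size_prod_XsubC s id) sw.
move: (size q) (size s) => a b; lia.
Qed.

End DoubleZeros.

(** * The cone spanned by the kernels *)

Section KernelCone.
Variables (R : realType) (n r : nat) (p : n.+1.-tuple {poly_n.+1 R}).
Hypothesis hp : orthonormal_basis p.
Local Notation k := (kernel_poly r p).

(** A pair (rho, t) stands for the weight rho at the node t. *)
Definition conic_kernel_sum (s : seq (R * R)) : {poly_n.+1 R} :=
  \sum_(u <- s) u.1 *: k u.2.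

Definition kernel_cone : set {poly_n.+1 R} :=
  [set w | exists2 s : seq (R * R),
    forall u, u \in s -> 0 <= u.1 /\ u.2 \in `[-1, 1] & w = conic_kernel_sum s].

Lemma kernel_coneD y z : kernel_cone y -> kernel_cone z -> kernel_cone (y + z).
Proof.
move=> [s s0 ->] [t t0 ->]; exists (s ++ t).
  by move=> u; rewrite mem_cat => /orP[/s0|/t0].
by rewrite /conic_kernel_sum big_cat.
Qed.

Lemma kernel_coneZ (e : R) y : 0 <= e -> kernel_cone y -> kernel_cone (e *: y).
Proof.
move=> e0 [s s0 ->]; exists [seq (e * u.1, u.2) | u <- s].
  by move=> _ /mapP[u /s0[u1 u2] ->]; split=> //=; rewrite mulr_ge0.
rewrite /conic_kernel_sum big_map scaler_sumr.
by apply: eq_bigr => u _; rewrite scalerA.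
Qed.

Lemma mem_kernel_cone t : t \in `[-1, 1] -> kernel_cone (k t).
Proof.
move=> t1; exists [:: (1, t)].
  by move=> u; rewrite inE => /eqP ->; rewrite ler01.
by rewrite /conic_kernel_sum big_seq1 scale1r.
Qed.

Lemma dotL2_conic_kernel_sum s (h : {poly_n.+1 R}) :
  dotL2 (conic_kernel_sum s) h = \sum_(u <- s) u.1 * h^`(r).[u.2].
Proof.
rewrite /conic_kernel_sum raddf_sum /= dotL2_suml; apply: eq_bigr => u _.
by rewrite dotL2Zl dotL2C (kernel_polyE hp).
Qed.

Lemma kernel_cone_free w : kernel_cone w ->
  exists m (rho alpha : 'I_m -> R),
    [/\ (m <= n.+1)%N, w = \sum_i rho i *: k (alpha i), forall i, 0 < rho i,
        forall i, alpha i \in `[-1, 1] & free [tuple k (alpha i) | i < m]].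
Proof.
move=> [s s0 ->]; have s0' i := s0 _ (mem_tnth i (in_tuple s)).
pose f := tnth (in_tuple s).
have [m [g [rho [rho0 fr E]]]] :=
  conic_caratheodory (fun i => k (f i).2) (fun i => (s0' i).1).
exists m, rho, (fun i => (f (g i)).2); split=> //.
- have := dimvS (subvf <<[tuple k (f (g i)).2 | i < m]>>%VS).
  by rewrite dim_polyn (eqP fr) size_tuple.
- by rewrite -E /conic_kernel_sum big_tnth.
- by move=> i; case: (s0' (g i)).
Qed.

(** Padding with the weight 0 at the node 0 brings every representation to the
same length n + 1, so that K is the image of a fixed product of intervals. *)
Lemma kernel_cone_padded w : kernel_cone w ->
  exists2 s : seq (R * R), size s = n.+1 &
    (forall u, u \in s -> 0 <= u.1 /\ u.2 \in `[-1, 1]) /\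
    w = conic_kernel_sum s.
Proof.
move=> /kernel_cone_free[m [rho [alpha [mn -> rho0 alpha1 _]]]].
exists ([seq (rho i, alpha i) | i <- enum 'I_m] ++ nseq (n.+1 - m) (0, 0)).
  by rewrite size_cat size_map size_enum_ord size_nseq subnKC.
split.
  move=> u; rewrite mem_cat => /orP[/mapP[i _ ->]|].
    by split; [exact/ltW/rho0 | exact: alpha1].
  rewrite mem_nseq => /andP[_ /eqP ->] /=.
  by rewrite lexx in_itv /= lerN10 ler01.
rewrite /conic_kernel_sum big_cat big_map big_enum /= -[LHS]addr0; congr (_ + _).
by rewrite big_nseq; elim: (_ - _)%N => //= j <-; rewrite scale0r addr0.
Qed.

(** The total weight of a combination is its inner product with q = X^r / r!,
because q^(r) = 1.  The bound then comes from expanding the squares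
|v - w + q|^2 >= 0 and |v - q|^2 >= 0. *)
Lemma kernel_cone_bounded (hrn : (r < n)%N) (v : {poly_n.+1 R}) :
  exists2 M, 0 <= M & forall s,
    dotL2 (v - conic_kernel_sum s) (v - conic_kernel_sum s) <= dotL2 v v ->
    \sum_(u <- s) u.1 <= M.
Proof.
pose q : {poly_n.+1 R} := npolyp n.+1 (r`!%:R^-1 *: 'X^r).
have qE : q^`(r) = 1.
  rewrite npolypK; last first.
    by rewrite (leq_trans (size_scale_leq _ _))// size_polyXn ltnS ltnW.
  rewrite derivnZ derivnXn subnn expr0 ffactnn.
  by rewrite -(scaler_nat _ (1 : {poly R})) scalerA mulVf ?scale1r.
exists (dotL2 v v + dotL2 q q); first by rewrite addr_ge0 ?dotL2_ge0.
move=> s; set w := conic_kernel_sum s => wv.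
have -> : \sum_(u <- s) u.1 = dotL2 w q.
  by rewrite dotL2_conic_kernel_sum qE; apply: eq_bigr => u _; rewrite hornerC mulr1.
have := dotL2_ge0 (polyn v - polyn w - -1 *: polyn q).
have := dotL2_ge0 (polyn v - polyn q).
move: wv; rewrite !dotL2_sqrB !dotL2Zr dotL2Zl dotL2Bl; lra.
Qed.

(** A vector u lists n + 1 weights followed by n + 1 nodes.  Weights above the
bound M of [kernel_cone_bounded] only produce points farther from v than the
origin, so the minimum over the box A is a minimum over all of K. *)
Lemma kernel_cone_nearest (hrn : (r < n)%N) (v : {poly_n.+1 R}) :
  exists w, best_approx kernel_cone v w.
Proof.
have [M M0 bound] := kernel_cone_bounded hrn v.
pose S (u : 'rV[R]_(n.+1 + n.+1)) : seq (R * R) :=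
  [seq (u ord0 (lshift n.+1 i), u ord0 (rshift n.+1 i)) | i <- enum 'I_n.+1].
pose W u := conic_kernel_sum (S u).
pose g u := dotL2 (v - W u) (v - W u).
pose B (i : 'I_(n.+1 + n.+1)) : set R :=
  if fintype.split i is inl _ then [set` `[0, M]] else [set` `[-1, 1]].
pose A := [set u : 'rV[R]_(n.+1 + n.+1) | forall i, B i (u ord0 i)].
have Al u i : A u -> 0 <= u ord0 (lshift n.+1 i) <= M.
  by move=> /(_ (lshift n.+1 i)); rewrite /B (unsplitK (inl i)) /= in_itv.
have Ar u i : A u -> u ord0 (rshift n.+1 i) \in `[-1, 1].
  by move=> /(_ (rshift n.+1 i)); rewrite /B (unsplitK (inr i)) /=.
have W0 : W 0 = 0.
  rewrite /W /conic_kernel_sum big_map big1 // => i _.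
  by rewrite mxE scale0r.
have A0 : A 0.
  move=> i; rewrite /B mxE; case: fintype.split => _ /=; rewrite in_itv /=.
    by rewrite lexx M0.
  by rewrite lerN10 ler01.
(* In coordinates the squared distance is visibly continuous in u. *)
have gE u : g u = \sum_(j < n.+1) (dotL2 v (tnth p j) -
    \sum_(i < n.+1) u ord0 (lshift n.+1 i) *
       (tnth p j)^`(r).[u ord0 (rshift n.+1 i)]) ^+ 2.
  rewrite /g.
  rewrite (parseval hp); apply: eq_bigr => j _.
  rewrite raddfB /= dotL2Bl; congr ((_ - _) ^+ 2).
  by rewrite dotL2_conic_kernel_sum big_map big_enum.
have gC : continuous g.
  rewrite (funext gE).
  have sumC (F : 'I_n.+1 -> 'rV[R]_(n.+1 + n.+1) -> R) :
      (forall i, continuous (F i)) -> continuous (fun u => \sum_(i < n.+1) F i u).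
    move=> FC; apply: (@continuous_big _ _ +%R 0 xpredT) => //.
    exact: add_continuous.
  have sqC (F : 'rV[R]_(n.+1 + n.+1) -> R) :
      continuous F -> continuous (fun u => F u ^+ 2).
    by move=> FC u; exact: (cvgM (FC u) (FC u)).
  apply: (sumC _ _) => j; apply: sqC.
  have tC : continuous (fun u : 'rV[R]_(n.+1 + n.+1) => \sum_(i < n.+1)
      u ord0 (lshift n.+1 i) * (tnth p j)^`(r).[u ord0 (rshift n.+1 i)]).
    apply: (sumC _ _) => i u.
    have cC l := @coord_continuous R 1 _ ord0 l u.
    have hC := @cvg_comp _ _ _ _ _ _ _ _ (cC (rshift n.+1 i))
      (@continuous_horner _ (tnth p j)^`(r) _).
    have mC := cvgM (cC (lshift n.+1 i)) hC.
    exact: mC.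
  by move=> u; exact: (cvgB (cvg_cst _) (tC u)).
have AC : compact A.
  apply: rV_compact => i; rewrite /B; case: fintype.split => _;
    exact: segment_compact.
have [c cA cmin] : exists2 c, c \in A & forall u, u \in A -> g c <= g u.
  apply: compact_EVT_min => //; first by exists 0.
  exact: continuous_subspaceT.
rewrite inE in cA.
exists (W c); split.
  exists (S c) => // _ /mapP[i _ ->] /=; split; last exact: Ar.
  by have /andP[] := Al c i cA.
move=> z /kernel_cone_padded[s ss [s0 ->]].
rewrite le_normL2 -/(g c).
have [small|/ltW big] := leP (dotL2 (v - conic_kernel_sum s)
    (v - conic_kernel_sum s)) (dotL2 v v); last first.
  apply: le_trans big.
  have := cmin 0; rewrite inE => /(_ A0) /le_trans; apply.
  by rewrite /g W0 subr0.
pose u : 'rV[R]_(n.+1 + n.+1) := 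
  row_mx (\row_i (nth (0, 0) s i).1) (\row_i (nth (0, 0) s i).2).
have Su : S u = s.
  apply: (@eq_from_nth _ (0, 0)); rewrite size_map size_enum_ord ?ss// => i iN.
  rewrite (nth_map ord0) ?size_enum_ord// row_mxEl row_mxEr !mxE.
  by rewrite nth_enum_ord//; case: nth.
have uA : A u.
  move=> l; rewrite -(splitK l) /B unsplitK.
  have s_i (i : 'I_n.+1) : nth (0, 0) s i \in s by rewrite mem_nth ?ss.
  case: fintype.split => i; rewrite /= ?row_mxEl ?row_mxEr mxE.
    2: exact: (s0 _ (s_i i)).2.
  rewrite in_itv /= (s0 _ (s_i i)).1 /=; apply: le_trans (bound s small).
  rewrite (big_rem _ (s_i i))/= lerDl big_seq sumr_ge0// => y /mem_rem /s0[].
  by [].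
have := cmin u; rewrite inE => /(_ uA) /le_trans; apply.
by rewrite /g /W Su.
Qed.

(** The bipolar theorem for K; the closedness of K that it requires enters
through the existence of a nearest point. *)
Lemma kernel_cone_dual (hrn : (r < n)%N) (v : {poly_n.+1 R}) :
  (forall z, nnderiv_cone R n r z -> 0 <= dotL2 v z) -> kernel_cone v.
Proof.
move=> v0; have [w wv] := kernel_cone_nearest hrn v.
have [Kw _] := wv.
have [P ww] := nearest_polar kernel_coneD kernel_coneZ wv.
have wvE : polyn (w - v) = -1 *: (polyn v - polyn w).
  by rewrite raddfB scaleN1r opprB.
have Cwv : nnderiv_cone R n r (w - v).
  move=> t t1; rewrite -(kernel_polyE hp) wvE dotL2Zl mulN1r oppr_ge0.
  exact/P/mem_kernel_cone.
suff : w - v = 0 by move/eqP; rewrite subr_eq0 => /eqP <-.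
apply: dotL2_eq0; apply/eqP; rewrite eq_le dotL2_ge0 andbT.
have := v0 _ Cwv; rewrite wvE !dotL2Zr !dotL2Zl.
have := ww; rewrite dotL2C dotL2Br dotL2Bl !dotL2Br (dotL2C w v); lra.
Qed.

End KernelCone.

(** * Projection onto the polynomials with nonnegative r-th derivative *)

Lemma nnderiv_coneD (R : realType) n r (y z : {poly_n.+1 R}) :
  nnderiv_cone R n r y -> nnderiv_cone R n r z -> nnderiv_cone R n r (y + z).
Proof.
move=> y0 z0 t t1; have -> : polyn (y + z) = polyn y + polyn z by rewrite raddfD.
by rewrite derivnD hornerD addr_ge0 ?y0 ?z0.
Qed.

Lemma nnderiv_coneZ (R : realType) n r (e : R) (y : {poly_n.+1 R}) :
  0 <= e -> nnderiv_cone R n r y -> nnderiv_cone R n r (e *: y).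
Proof.
move=> e0 y0 t t1; have -> : polyn (e *: y) = e *: polyn y by rewrite linearZ.
by rewrite derivnZ hornerZ mulr_ge0 ?y0.
Qed.

Lemma size_derivn_npoly (R : realType) n r (y : {poly_n.+1 R}) :
  (size y^`(r) <= n.+1 - r)%N.
Proof.
apply/leq_sizeP => j jn; rewrite coef_derivn nth_default ?mul0rn//.
by rewrite (leq_trans (size_npoly _))//; lia.
Qed.

Lemma dotL2_representation (R : realType) n r (p : n.+1.-tuple {poly_n.+1 R})
    (x x0 z : {poly_n.+1 R}) m (rho alpha : 'I_m -> R) :
  orthonormal_basis p ->
  x0 = x + \sum_(i < m) rho i *: kernel_poly r p (alpha i) ->
  dotL2 (x - x0) z = - \sum_(i < m) rho i * z^`(r).[alpha i].
Proof.
move=> hp ->.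
rewrite raddfD /= opprD addrA subrr add0r -scaleN1r dotL2Zl mulN1r.
rewrite raddf_sum /= dotL2_suml; congr (- _); apply: eq_bigr => i _.
by rewrite dotL2Zl dotL2C (kernel_polyE hp).
Qed.

(** By [nearest_polar], x0 - x is nonnegative on the cone, hence lies in the
cone spanned by the kernels; complementary slackness <x0 - x, x0> = 0 places
the nodes at zeros of x0^(r). *)
Lemma best_approx_representation (R : realType) n r (hrn : (r < n)%N)
    (p : n.+1.-tuple {poly_n.+1 R}) (x x0 : {poly_n.+1 R}) :
  orthonormal_basis p -> best_approx (nnderiv_cone R n r) x x0 ->
  exists m (rho alpha : 'I_m -> R), kernel_representation r p x x0 rho alpha.
Proof.
move=> hp xx0; have [hx0 _] := xx0.
have [P x00] := nearest_polar (@nnderiv_coneD R n r) (@nnderiv_coneZ R n r) xx0.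
have /kernel_cone_free[m [rho [alpha [mn E rho0 alpha1 fr]]]] :
    kernel_cone r p (x0 - x).
  apply: (kernel_cone_dual hp hrn) => z /P; rewrite raddfB /= !dotL2Bl; lra.
have {}E : x0 = x + \sum_(i < m) rho i *: kernel_poly r p (alpha i).
  by rewrite -E addrC subrK.
exists m, rho, alpha; split=> // i; split=> //.
have := x00; rewrite (dotL2_representation _ hp E) => /eqP.
rewrite oppr_eq0 psumr_eq0 => [|j _]; last by rewrite mulr_ge0 ?hx0// ltW.
move=> /allP/(_ i (mem_index_enum i)) /=.
by rewrite mulf_eq0 gt_eqF//= => /eqP.
Qed.

Lemma representation_best_approx (R : realType) n r
    (p : n.+1.-tuple {poly_n.+1 R}) (x x0 : {poly_n.+1 R})
    m (rho alpha : 'I_m -> R) :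
  orthonormal_basis p -> nnderiv_cone R n r x0 ->
  kernel_representation r p x x0 rho alpha ->
  best_approx (nnderiv_cone R n r) x = [set x0].
Proof.
move=> hp hx0 [_ E rho0 alpha1 _]; apply: polar_nearest => // [z z0|].
  rewrite (dotL2_representation _ hp E) oppr_le0 sumr_ge0// => i _.
  by rewrite mulr_ge0 ?z0 ?ltW//; case: (alpha1 i).
rewrite (dotL2_representation _ hp E) big1 ?oppr0// => i _.
by rewrite (alpha1 i).2 mulr0.
Qed.

(** Linear independence makes the nodes distinct, so they can be counted as
zeros. *)
Lemma representation_size (R : realType) n r
    (p : n.+1.-tuple {poly_n.+1 R}) (x x0 : {poly_n.+1 R})
    m (rho alpha : 'I_m -> R) :
  nnderiv_cone R n r x0 -> x0^`(r) != 0 ->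
  kernel_representation r p x x0 rho alpha -> (2 * m <= n.+2 - r)%N.
Proof.
move=> hx0 q0 [_ _ _ alpha1 fr].
have := @nonneg_zero_count R x0^`(r) [seq alpha i | i <- enum 'I_m] q0 hx0.
rewrite size_map size_enum_ord => H.
suff : (2 * m < size x0^`(r) + 2)%N.
  by have := size_derivn_npoly r x0; move: q0; rewrite -size_poly_gt0; lia.
apply: H => [|_ /mapP[i _ ->]]; last exact: alpha1.
have := free_uniq fr.
rewrite /= (map_comp (kernel_poly r p) alpha).
exact: map_uniq.
Qed.

Theorem theorem3p20 (R : realType) (n r : nat) (hrn : (r < n)%N)
    (p : n.+1.-tuple {poly_n.+1 R}) (hp : orthonormal_basis p)
    (x x0 : {poly_n.+1 R})
    (hx : ~ nnderiv_cone R n r x) (hx0 : nnderiv_cone R n r x0) :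
  (best_approx (nnderiv_cone R n r) x = [set x0] <->
   exists (m : nat) (rho alpha : 'I_m -> R),
     kernel_representation r p x x0 rho alpha) /\
  (x0^`(r) <> 0 ->
   forall (m : nat) (rho alpha : 'I_m -> R),
     kernel_representation r p x x0 rho alpha ->
     m%:R <= 2^-1 * (n%:R - r%:R + 2) :> R).
Proof.
split; [split=> [xx0|[m [rho [alpha H]]]] | move=> /eqP q0 m rho alpha H].
- by apply: best_approx_representation => //; rewrite xx0.
- exact: representation_best_approx H.
- have := representation_size hx0 q0 H.
  rewrite leq_subRL; last by lia.
  rewrite -(ler_nat R) natrD natrM -[n.+2]addn2 natrD => H'.
  by rewrite ler_pdivlMl//; lra.
Qed.
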